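(* Let $\mathfrak X,\mathfrak Y$ be Polish spaces, let $\mu,\nu$ be probability measures on $\mathfrak X,\mathfrak Y$ respectively, and suppose that $c\in\mathcal C(\mu,\nu)$. For $(x,y)\in\mathfrak X\times\mathfrak Y$ let $c_{x,y}(x',y')=c(x,y,x',y')$ and $\hat c(x,y)=\mathsf C_{c_{x,y}}(\mu,\nu)$. Then $$\inf_{\pi\in\Pi(\mu,\nu)}\iint c\,\mathrm d\pi\otimes\mathrm d\pi\ \ge\ \mathsf C_{\hat c}(\mu,\nu).$$ Moreover, if there exists $\pi_*\in\Pi(\mu,\nu)$ such that $\pi_*$ is an optimal coupling in the classic optimal transport problem between $\mu$ and $\nu$ both for the cost function $\hat c$ and, for $\pi_*$-a.e. $(x,y)$, for the cost function $c_{x,y}$, then $\pi_*$ is a minimizer of $\pi\mapsto\iint c\,\mathrm d\pi\otimes\mathrm d\pi$ over $\Pi(\mu,\nu)$.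
   Context: $\Pi(\mu,\nu)$ is the set of all probability measures on $\mathfrak X\times\mathfrak Y$ with marginals $\mu$ and $\nu$, and $\iint c\,\mathrm d\pi\otimes\mathrm d\pi=\iint c(x,y,x',y')\,\mathrm d\pi(x,y)\,\mathrm d\pi(x',y')$. For a cost function $b:\mathfrak X\times\mathfrak Y\to\mathbb R\cup\{\pm\infty\}$, $\mathsf C_b(\mu,\nu)=\inf_{\pi\in\Pi(\mu,\nu)}\int b(x,y)\,\mathrm d\pi(x,y)$ is the classic optimal transport cost, and an optimal coupling for $b$ is one attaining this infimum. $\mathcal C(\mu,\nu)$ is the set of functions $c:(\mathfrak X\times\mathfrak Y)^2\to\mathbb R$ such that there exist $f\in L^1(\mu\otimes\mu)$ and $g\in L^1(\nu\otimes\nu)$ with $c(x,y,x',y')\ge f(x,x')+g(y,y')$ everywhere. Suitable measurability of the cost functions involved is tacitly assumed so that the integrals are meaningful. *)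

(* Defs.v *)
From mathcomp Require Export all_boot all_order all_algebra.
From mathcomp Require Export all_classical all_reals all_analysis measurable_realfun.

Set Implicit Arguments.
Unset Strict Implicit.
Unset Printing Implicit Defensive.

Import Order.TTheory GRing.Theory Num.Theory.
Import numFieldNormedType.Exports.

Local Open Scope classical_set_scope.
Local Open Scope ring_scope.
Local Open Scope ereal_scope.

Definition is_metric (R : realType) (T : Type) (d : T -> T -> R) : Prop :=
  [/\ forall x y, (0 <= d x y)%R,
      forall x y, d x y = 0%R <-> x = y,
      forall x y, d x y = d y x &
      forall x y z, (d x z <= d x y + d y z)%R].

Definition metrizes (R : realType) (T : topologicalType) (d : T -> T -> R) :
    Prop :=
  forall (x : T) (A : set T),
    nbhs x A <-> exists2 e : R, (0 < e)%R & [set y | (d x y < e)%R] `<=` A.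

Definition complete_metric (R : realType) (T : topologicalType)
    (d : T -> T -> R) : Prop :=
  forall u : nat -> T,
    (forall e : R, (0 < e)%R -> exists N : nat,
       forall m n : nat, (N <= m)%N -> (N <= n)%N -> (d (u m) (u n) < e)%R) ->
    exists l : T, u @ \oo --> l.

(* The metric is existentially quantified: being Polish is a property of the
   topology alone. *)
Definition polish_space (R : realType) (T : topologicalType) : Prop :=
  (exists2 D : set T, countable D & dense D) /\
  (exists d : T -> T -> R, [/\ is_metric d, metrizes d & complete_metric d]).

(* T equipped with its Borel sigma-algebra.  On a product of Polish spaces,
   which are second countable, the product of the Borel sigma-algebras carried
   by [borel X * borel Y] is the Borel sigma-algebra of the product. *)
Notation borel T := (g_sigma_algebraType (@open T)).

Section transport.
Context {dX dY : measure_display} {X : measurableType dX}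
  {Y : measurableType dY} {R : realType}.
Variables (mu : probability X R) (nu : probability Y R).

(* The marginals are compared on measurable sets only: the value of a measure
   elsewhere is irrelevant. *)
Definition couplings : set (probability (X * Y)%type R) :=
  [set pi | (forall A, measurable A -> pushforward pi fst A = mu A) /\
            (forall B, measurable B -> pushforward pi snd B = nu B)].

Definition ot_cost (b : X * Y -> \bar R) : \bar R :=
  ereal_inf [set \int[pi]_z b z | pi in couplings].

Definition optimal_coupling (b : X * Y -> \bar R)
    (pi : probability (X * Y)%type R) : Prop :=
  couplings pi /\ \int[pi]_z b z = ot_cost b.

Definition cost_class : set ((X * Y) * (X * Y) -> R) :=
  [set c | exists (f : X * X -> R) (g : Y * Y -> R),
     [/\ (mu \x mu).-integrable setT (EFin \o f),
         (nu \x nu).-integrable setT (EFin \o g) &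
         forall x y x' y', (f (x, x') + g (y, y') <= c ((x, y), (x', y')))%R]].

Definition section_cost (c : (X * Y) * (X * Y) -> R) (z : X * Y) :
    X * Y -> \bar R :=
  fun z' => (c (z, z'))%:E.

Definition hat_cost (c : (X * Y) * (X * Y) -> R) (z : X * Y) : \bar R :=
  ot_cost (section_cost c z).

Definition quadratic_cost (c : (X * Y) * (X * Y) -> R)
    (pi : probability (X * Y)%type R) : \bar R :=
  \int[pi \x pi]_w (c w)%:E.

Definition quadratic_minimizer (c : (X * Y) * (X * Y) -> R)
    (pi : probability (X * Y)%type R) : Prop :=
  couplings pi /\
  forall pi', couplings pi' -> quadratic_cost c pi <= quadratic_cost c pi'.

(* Measurability with respect to the pi-completion, for every coupling pi.
   This is what an infimum over couplings, such as [hat_cost c] with c Borel,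
   can be expected to satisfy: in general it is universally measurable but
   need not be Borel.  The integral of such a function is that of any Borel
   function it agrees with pi-almost everywhere. *)
Definition coupling_measurable (b : X * Y -> \bar R) : Prop :=
  forall pi, couplings pi ->
    exists2 h : X * Y -> \bar R,
      measurable_fun setT h & {ae pi, forall z, b z = h z}.

End transport.

(* Main.v *)
Require Import Defs.

(** For a coupling [pi], write [I(z)] for the integral of [c (z, z')] in [z']
    against [pi].  Fubini turns the quadratic cost into the integral of [I]
    against [pi].  Since [pi] competes in the transport problem of each section
    of [c], the hat cost lies below [I] pointwise; and [pi] also competes in the
    transport problem of the hat cost.  Hence
      [quadratic_cost c pi = \int[pi]_z I z
         >= \int[pi]_z hat_cost c z >= ot_cost (hat_cost c)],
    which is the lower bound ([ot_cost_hat_le]).  For the coupling of the second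
    claim, optimality for almost every section turns the first inequality into
    an equality and optimality for the hat cost does so for the second; its
    quadratic cost thus equals the lower bound, so it is a minimizer.

    Two points need care.  First, [c] need not be integrable, only bounded
    below by an integrable function; Fubini is therefore proved for functions
    whose negative part has a finite integral ([fubini_lower_integrable]), and
    this finiteness, for every coupling, comes from the class of [c] because
    [pi \x pi] projects onto [mu \x mu] and [nu \x nu]
    ([integral_quadratic_cost_funeneg]).  Second, the hat cost is an infimum
    over couplings and need not be Borel.  For such a function the integral of
    a positive or negative part is the supremum over the simple functions below
    it; this is still monotone ([integral_monotone]), and it takes the expected
    value on any function that is almost everywhere equal to a measurable one
    ([ae_eq_integral_nonmeasurable]). *)

Set Implicit Arguments.
Unset Strict Implicit.
Unset Printing Implicit Defensive.

Import Order.TTheory GRing.Theory Num.Theory.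
Import numFieldNormedType.Exports.
Local Open Scope classical_set_scope.
Local Open Scope ring_scope.
Local Open Scope ereal_scope.

(** * Integrals of functions that need not be measurable *)

Section nonmeasurable_integrand.
Context d (T : measurableType d) (R : realType).
Context (m : {measure set T -> \bar R}).

(** The integral of a nonnegative function is a supremum over the simple
    functions below it, and this set grows with the function.  Subtraction of
    negative parts is harmless even at infinity, because
    [+oo - +oo = -oo] keeps subtraction monotone. *)
Lemma integral_monotone (f g : T -> \bar R) :
  (forall x, f x <= g x) -> \int[m]_x f x <= \int[m]_x g x.
Proof.
move=> fg; rewrite integralE [leRHS]integralE.
apply: leeB; rewrite !ge0_integralTE //; apply: le_ereal_sup => _ [h hle <-];
  exists h => // x; apply: le_trans (hle x) _.
  by rewrite !funeposE ge_max !le_max lexx orbT fg.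
by rewrite !funenegE ge_max !le_max lexx orbT leeN2 fg.
Qed.

(** Replacing [g] by [-oo] or by [+oo] on a measurable null set that contains
    the exceptional points gives two measurable functions with the same
    integral as [g], and [f] lies between them. *)
Lemma ae_eq_integral_nonmeasurable (f g : T -> \bar R) :
  measurable_fun setT g -> {ae m, forall x, f x = g x} ->
  \int[m]_x f x = \int[m]_x g x.
Proof.
move=> mg [N [mN N0 fgN]].
have fg x : ~ N x -> f x = g x by move=> Nx; apply: contra_notP Nx => /fgN.
have mpatch e : measurable_fun setT (fun x => if x \in N then e else g x).
  apply: measurable_fun_if => //.
    apply: (measurable_fun_bool true); rewrite setTI.
    rewrite (_ : _ @^-1` _ = N)//; apply/seteqP.
    by split=> x /=; [move/set_mem|move/mem_set].
  exact: measurable_funS mg.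
have intpatch e :
    \int[m]_x (if x \in N then e else g x) = \int[m]_x g x.
  apply: ae_eq_integral => //; exists N; split=> // x /= xN.
  by apply: contrapT => Nx; apply: xN => _; rewrite memNset.
apply/eqP; rewrite eq_le; apply/andP; split.
  rewrite -(intpatch +oo); apply: integral_monotone => x.
  by case: ifPn => [_|/negP]; rewrite ?leey// inE => /fg ->.
rewrite -(intpatch -oo); apply: integral_monotone => x.
by case: ifPn => [_|/negP]; rewrite ?leNye// inE => /fg ->.
Qed.

End nonmeasurable_integrand.

(** * Fubini for functions with integrable negative part *)

Section lower_integrable.
Context (R : realType).

(** Additivity for integrable functions does not apply, as [p] may have an
    infinite integral.  The identity [p + (p - n)^- = (p - n)^+ + n] involves
    nonnegative functions only, so it can be integrated term by term, and the
    two subtracted integrals are finite. *)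
Lemma integral_ge0_sub d (T : measurableType d)
    (m : {measure set T -> \bar R}) (p n : T -> \bar R) :
  measurable_fun setT p -> measurable_fun setT n ->
  (forall x, 0 <= p x) -> (forall x, 0 <= n x) ->
  \int[m]_x n x < +oo ->
  \int[m]_x (p x - n x) = \int[m]_x p x - \int[m]_x n x.
Proof.
move=> mp mn p0 n0 noo; pose b x := p x - n x.
have mb : measurable_fun setT b by exact: emeasurable_funB.
have mbp : measurable_fun setT b^\+ by exact: measurable_funepos.
have mbn : measurable_fun setT b^\- by exact: measurable_funeneg.
(* The case p x = n x = +oo is covered too: there p x - n x = -oo, and both
   sides are infinite. *)
have balance x : p x + b^\- x = b^\+ x + n x.
  rewrite funeposE funenegE /b; move: (p0 x) (n0 x).
  case: (p x) (n x) => [u||] [v||] //= u0 v0.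
  - rewrite -EFinB -!EFin_max -!EFinD; congr (_%:E).
    case: (leP (u - v)%R 0%R) => h.
      by rewrite max_l ?oppr_ge0// opprB add0r addrC subrK.
    by rewrite max_r ?oppr_le0 ?ltW// addr0 subrK.
  - by rewrite addeNy /Order.max (ltNge +oo) leey ltNy0/= add0e addey.
  - rewrite [_ + (- v)%:E]addye// /Order.max (ltNge +oo) leey ltNy0/=.
    by rewrite addr0 addye.
  - by rewrite addeNy /Order.max (ltNge +oo) leey ltNy0/=.
have bn x : b^\- x <= n x.
  rewrite funenegE ge_max n0 andbT /b; move: (p0 x) (n0 x).
  case: (p x) (n x) => [u||] [v||] //= u0 v0; rewrite ?leey ?leNye//.
  by rewrite lee_fin opprB lerBlDr lerDl.
have bnoo : \int[m]_x b^\- x < +oo.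
  by apply: le_lt_trans noo; exact: integral_monotone.
have : \int[m]_x p x + \int[m]_x b^\- x = \int[m]_x b^\+ x + \int[m]_x n x.
  by rewrite -!ge0_integralD//; apply: eq_integral => x _; exact: balance.
rewrite [\int[m]_x (p x - n x)]integralE -/b.
have : \int[m]_x n x \is a fin_num by rewrite ge0_fin_numE// integral_ge0.
have : \int[m]_x b^\- x \is a fin_num by rewrite ge0_fin_numE// integral_ge0.
move: (\int[m]_x p x) (\int[m]_x b^\+ x).
case: (\int[m]_x n x) (\int[m]_x b^\- x) => [v||] [w||]// [u||] [z||]//= _ _.
move=> -[uwzv]; congr _%:E.
by apply/eqP; rewrite subr_eq addrAC eq_sym subr_eq uwzv.
Qed.

(** Tonelli applies to the positive and to the negative part.  The inner
    integral is the difference of the two partial integrals by definition, and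
    the finite integral of the negative part lets the outer integral split. *)
Lemma fubini_lower_integrable d1 d2 (T1 : measurableType d1)
    (T2 : measurableType d2) (m1 : {sigma_finite_measure set T1 -> \bar R})
    (m2 : {sigma_finite_measure set T2 -> \bar R}) (f : T1 * T2 -> \bar R) :
  measurable_fun setT f -> \int[m1 \x m2]_z f^\- z < +oo ->
  measurable_fun setT (fun x => \int[m2]_y f (x, y)) /\
  \int[m1 \x m2]_z f z = \int[m1]_x \int[m2]_y f (x, y).
Proof.
move=> mf foo.
have mfp : measurable_fun setT f^\+ by exact: measurable_funepos.
have mfn : measurable_fun setT f^\- by exact: measurable_funeneg.
have mP := measurable_fun_fubini_tonelli_F (m2 := m2) _ mfp (funepos_ge0 f).
have mN := measurable_fun_fubini_tonelli_F (m2 := m2) _ mfn (funeneg_ge0 f).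
have FE : (fun x => \int[m2]_y f (x, y)) =
    fun x => fubini_F m2 f^\+ x - fubini_F m2 f^\- x.
  apply/funext => x; rewrite integralE; congr (_ - _);
    by apply: eq_integral => y _; rewrite ?funeposE ?funenegE.
rewrite FE; split; first exact: emeasurable_funB.
move: foo; rewrite fubini_tonelli1// => foo.
rewrite integral_ge0_sub//; try by move=> x; exact: integral_ge0.
by rewrite [LHS]integralE !fubini_tonelli1.
Qed.

End lower_integrable.

(** * Integration of functions of a marginal *)

Section transport.
Context (R : realType).

Lemma integral_marginal d d' (Z : measurableType d) (T : measurableType d')
    (p : Z -> T) (pi : probability Z R) (mu : probability T R)
    (f : T -> \bar R) :
  measurable_fun setT p ->
  (forall A, measurable A -> pushforward pi p A = mu A) ->
  measurable_fun setT f -> (forall x, 0 <= f x) ->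
  \int[pi]_z f (p z) = \int[mu]_x f x.
Proof.
move=> mp pimu mf f0.
rewrite [RHS](eq_measure_integral (pushforward pi p)); last first.
  by move=> A mA _; exact/esym/pimu.
by rewrite [RHS]ge0_integral_pushforward// preimage_setT.
Qed.

(** The image of [pi \x pi] under [p] in both coordinates is [mu \x mu]; by
    Tonelli the change of variables can be made in one coordinate at a time. *)
Lemma integral_marginal2 d d' (Z : measurableType d) (T : measurableType d')
    (p : Z -> T) (pi : probability Z R) (mu : probability T R)
    (f : T * T -> \bar R) :
  measurable_fun setT p ->
  (forall A, measurable A -> pushforward pi p A = mu A) ->
  measurable_fun setT f -> (forall x, 0 <= f x) ->
  \int[pi \x pi]_w f (p w.1, p w.2) = \int[mu \x mu]_x f x.
Proof.
move=> mp pimu mf f0.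
have mfp : measurable_fun setT (fun w : Z * Z => f (p w.1, p w.2)).
  apply: (measurableT_comp mf); apply: measurable_fun_pair.
    exact: measurableT_comp mp measurable_fst.
  exact: measurableT_comp mp measurable_snd.
rewrite !fubini_tonelli1//.
under eq_integral => z _.
  rewrite /fubini_F /= (integral_marginal (f := fun x => f (p z, x)) mp pimu)//;
    last exact: measurableT_comp.
  over.
rewrite (integral_marginal (f := fubini_F mu f) mp pimu)//.
- exact: measurable_fun_fubini_tonelli_F.
- by move=> x; exact: integral_ge0.
Qed.

End transport.

(** * The quadratic cost and the hat cost *)

Section quadratic_transport.
Context {dX dY : measure_display} {X : measurableType dX}
  {Y : measurableType dY} {R : realType}.
Context (mu : probability X R) (nu : probability Y R)
  (c : (X * Y) * (X * Y) -> R).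
Context (mc : measurable_fun setT c) (c_class : cost_class mu nu c).

(** From [c >= f + g], the negative part of [c] is at most [|f| + |g|], where
    [f] sees only the first marginal and [g] only the second: its integral is
    bounded by the norms of [f] and [g] in L^1, whatever the coupling. *)
Lemma integral_quadratic_cost_funeneg pi : couplings mu nu pi ->
  \int[pi \x pi]_w (EFin \o c)^\- w < +oo.
Proof.
case=> pimu pinu.
have [f [g [/integrableP[mf foo] /integrableP[mg goo] fgc]]] := c_class.
pose F (w : (X * Y) * (X * Y)) : \bar R := `|(f (w.1.1, w.2.1))%:E|.
pose G (w : (X * Y) * (X * Y)) : \bar R := `|(g (w.1.2, w.2.2))%:E|.
have mF : measurable_fun setT (fun x : X * X => `|(f x)%:E|).
  exact: measurableT_comp.
have mG : measurable_fun setT (fun y : Y * Y => `|(g y)%:E|).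
  exact: measurableT_comp.
have mFw : measurable_fun setT F.
  have mp : measurable_fun setT
      (fun w : (X * Y) * (X * Y) => (w.1.1, w.2.1)).
    apply: measurable_fun_pair.
      exact: measurableT_comp measurable_fst measurable_fst.
    exact: measurableT_comp measurable_fst measurable_snd.
  exact: measurableT_comp mF mp.
have mGw : measurable_fun setT G.
  have mp : measurable_fun setT
      (fun w : (X * Y) * (X * Y) => (w.1.2, w.2.2)).
    apply: measurable_fun_pair.
      exact: measurableT_comp measurable_snd measurable_fst.
    exact: measurableT_comp measurable_snd measurable_snd.
  exact: measurableT_comp mG mp.
have Foo : \int[pi \x pi]_w F w < +oo.
  by rewrite (integral_marginal2 (f := fun x => `|(f x)%:E|) _ pimu).
have Goo : \int[pi \x pi]_w G w < +oo.
  by rewrite (integral_marginal2 (f := fun x => `|(g x)%:E|) _ pinu).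
apply: (@le_lt_trans _ _ (\int[pi \x pi]_w (F w + G w))).
  apply: integral_monotone => -[[x y] [x' y']].
  rewrite funenegE /F /G /= ge_max -EFinD !lee_fin addr_ge0// andbT.
  rewrite lerNl opprD; apply: le_trans (fgc _ _ _ _).
  by rewrite lerD// lerNl ler_normr lexx orbT.
rewrite ge0_integralD//; first exact: lte_add_pinfty.
  by move=> w _; exact: abse_ge0.
by move=> w _; exact: abse_ge0.
Qed.

Lemma quadratic_cost_fubini pi : couplings mu nu pi ->
  measurable_fun setT (fun z => \int[pi]_z' section_cost c z z') /\
  quadratic_cost c pi = \int[pi]_z \int[pi]_z' section_cost c z z'.
Proof.
move=> cpi.
have mcE : measurable_fun setT (EFin \o c) by exact/measurable_EFinP.
exact: fubini_lower_integrable mcE (integral_quadratic_cost_funeneg cpi).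
Qed.

Lemma ot_cost_hat_le pi : couplings mu nu pi ->
  ot_cost mu nu (hat_cost mu nu c) <= quadratic_cost c pi.
Proof.
move=> cpi; have [_ ->] := quadratic_cost_fubini cpi.
apply: (@le_trans _ _ (\int[pi]_z hat_cost mu nu c z)).
  by apply: ereal_inf_lbound; exists pi.
by apply: integral_monotone => z; apply: ereal_inf_lbound; exists pi.
Qed.

End quadratic_transport.

Theorem proposition4 (R : realType) (X Y : ptopologicalType)
    (polishX : polish_space R X) (polishY : polish_space R Y)
    (mu : probability (borel X) R) (nu : probability (borel Y) R)
    (c : (borel X * borel Y) * (borel X * borel Y) -> R)
    (c_meas : measurable_fun setT c)
    (hat_c_meas : coupling_measurable mu nu (hat_cost mu nu c))
    (c_class : cost_class mu nu c) :
  ot_cost mu nu (hat_cost mu nu c)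
    <= ereal_inf [set quadratic_cost c pi | pi in couplings mu nu]
  /\
  (forall pi_star : probability (borel X * borel Y)%type R,
     couplings mu nu pi_star ->
     optimal_coupling mu nu (hat_cost mu nu c) pi_star ->
     {ae pi_star, forall z,
        optimal_coupling mu nu (section_cost c z) pi_star} ->
     quadratic_minimizer mu nu c pi_star).
Proof.
split; first by apply: le_ereal_inf_tmp => _ [pi cpi <-]; exact: ot_cost_hat_le.
move=> pi cpi [_ hat_opt] sec_opt; split=> // pi' cpi'.
have [mI ->] := quadratic_cost_fubini c_meas c_class cpi.
(* By optimality of almost every section, the inner integral is the hat cost
   almost everywhere. *)
rewrite -(ae_eq_integral_nonmeasurable mI (f := hat_cost mu nu c)).
  by rewrite hat_opt; exact: ot_cost_hat_le.
by apply: filterS sec_opt => z [_ ->].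
Qed.
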